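(* Let $K$ be an infinite field of characteristic different from $2$ and $3$, and suppose that $A$ is a subalgebra of a Bernstein algebra over $K$. Then the generalized Jacobian conjecture for quadratic mappings holds for $A$; that is, if $A$ is Engel, then $A$ is Yagzhev (weakly nilpotent).
   Context: Algebras are not assumed associative, unital or finite-dimensional. A Bernstein algebra over $K$ is a commutative $K$-algebra $B$ with a nonzero algebra homomorphism $\omega:B\to K$ satisfying $(x^2)^2=\omega(x)^2x^2$ for all $x$. Let $A$ be a commutative algebra. $A$ is Engel if there is $p>0$ such that $L_x^p(y)=0$ for all $x,y\in A$, where $L_x(y)=xy$. For $q\ge1$, $T_q(x)$ denotes the sum of all products of $q$ copies of $x$ over all arrangements of parentheses (i.e. the sum of all multilinear multiple compositions of the multiplication with $q$ arguments, all arguments set equal to $x$); so $T_1(x)=x$ and $T_q(x)=\sum_{i=1}^{q-1}T_i(x)T_{q-i}(x)$ for $q\ge 2$. $A$ is weakly nilpotent, or Yagzhev, if there is $q_0>0$ such that $T_q(x)=0$ for all $x\in A$ and all $q\ge q_0$. *)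

(* Defs.v *)
From HB Require Import structures.
From mathcomp Require Import all_boot all_algebra.
From mathcomp Require Import boolp classical_sets functions cardinality.

Set Implicit Arguments.
Unset Strict Implicit.
Unset Printing Implicit Defensive.

Import GRing.Theory.

Local Open Scope ring_scope.

(* A K-algebra, not assumed associative, unital or finite-dimensional, is an
   lmodType B over K with a multiplication mul : {bilinear B -> B -> B};
   subalgebras are classical sets of elements of B, and the properties of a
   subalgebra A are stated with all variables ranging over A. *)

Section Algebras.
Variables (K : fieldType) (B : lmodType K) (mul : {bilinear B -> B -> B}).

Definition bernstein_weight (omega : {scalar B}) : Prop :=
  [/\ exists x, omega x != 0,
      forall x y, omega (mul x y) = omega x * omega y
    & forall x, mul (mul x x) (mul x x) = omega x ^+ 2 *: mul x x].

Definition bernstein : Prop :=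
  commutative mul /\ exists omega : {scalar B}, bernstein_weight omega.

Definition subalgebra (A : set B) : Prop :=
  [/\ A 0,
      forall a x y, A x -> A y -> A (a *: x + y)
    & forall x y, A x -> A y -> A (mul x y)].

Definition engel (A : set B) : Prop :=
  exists2 p, (0 < p)%N & forall x y, A x -> A y -> iter p (mul x) y = 0.

End Algebras.

Inductive bracketing := Leaf | Node of bracketing & bracketing.

Fixpoint leaves (t : bracketing) : nat :=
  if t is Node l r then (leaves l + leaves r)%N else 1%N.

(* The bracketings of height at most h, each listed once. *)
Fixpoint bracketings (h : nat) : seq bracketing :=
  if h is h'.+1 then
    Leaf :: [seq Node l r | l <- bracketings h', r <- bracketings h']
  else [:: Leaf].

Section Yagzhev.
Variables (K : fieldType) (B : lmodType K) (mul : {bilinear B -> B -> B}).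

Fixpoint bracket_eval (x : B) (t : bracketing) : B :=
  if t is Node l r then mul (bracket_eval x l) (bracket_eval x r) else x.

(* A bracketing with q leaves has height less than q, so this is the sum of
   the products of q copies of x over all bracketings; see Tsum1 and TsumE. *)
Definition Tsum (q : nat) (x : B) : B :=
  \sum_(t <- bracketings q | leaves t == q) bracket_eval x t.

Definition yagzhev (A : set B) : Prop :=
  exists2 q0, (0 < q0)%N &
    forall x q, A x -> (q0 <= q)%N -> Tsum q x = 0.

End Yagzhev.

Lemma leaves_gt0 t : (0 < leaves t)%N.
Proof. by elim: t => //= l Hl r _; rewrite addn_gt0 Hl. Qed.

Section TsumTheory.
Variables (K : fieldType) (B : lmodType K) (mul : {bilinear B -> B -> B}).
Implicit Types (x : B) (q h : nat).

Let Th h q x := \sum_(t <- bracketings h | leaves t == q) bracket_eval mul x t.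

Let Th1 h x : Th h 1 x = x.
Proof.
rewrite /Th; case: h => [|h] /=; first by rewrite big_cons big_nil /= addr0.
rewrite big_cons /= big_mkcond big_allpairs_dep /= big1 ?addr0 // => l _.
rewrite big1 // => r _; case: eqP => // E.
by have := leaves_gt0 l; have := leaves_gt0 r; case: (leaves l) E => [|[|n]];
  case: (leaves r).
Qed.

Let ThS h q x : (1 < q)%N ->
  Th h.+1 q x = \sum_(1 <= i < q) mul (Th h i x) (Th h (q - i) x).
Proof.
move=> q1; rewrite /Th /= big_cons /= (ltn_eqF q1) big_mkcond.
rewrite big_allpairs_dep /=.
transitivity (\sum_(1 <= i < q) \sum_(l <- bracketings h | leaves l == i)
    \sum_(r <- bracketings h | leaves r == (q - i)%N)
      mul (bracket_eval mul x l) (bracket_eval mul x r)); last first.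
  apply: eq_bigr => i _; rewrite linear_sumlz.
  by apply: eq_bigr => l _; rewrite linear_sumr.
under [RHS]eq_bigr do rewrite big_mkcond /=.
rewrite [RHS]exchange_big /=; apply: eq_bigr => l _.
rewrite -[RHS]big_mkcond /=.
have [lq|ql] := ltnP (leaves l) q.
- rewrite [RHS]big_mkcond (bigD1_seq (leaves l)) ?iota_uniq //=; last first.
    by rewrite mem_index_iota leaves_gt0.
  rewrite eqxx [X in _ + X]big1 ?addr0 => [|i /negPf]; last first.
    by rewrite eq_sym => ->.
  rewrite [RHS]big_mkcond; apply: eq_bigr => r _.
  by rewrite -(eqn_add2l (leaves l) (leaves r)) subnKC // ltnW.
- rewrite [RHS]big_nat_cond [RHS]big1 => [|i /andP[/andP[_ iq] /eqP E]]; last first.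
    by rewrite -E ltnNge ql in iq.
  rewrite big1 // => r _; case: eqP => // E.
  by have := leaves_gt0 r; rewrite -(ltn_add2l (leaves l)) addn0 E ltnNge ql.
Qed.

Let Th_stable h q x : (q <= h.+1)%N -> Th h q x = Tsum mul q x.
Proof.
have T0 k : Th k 0 x = 0.
  by rewrite /Th big1 // => t /eqP t0; have := leaves_gt0 t; rewrite t0.
suff H k : forall h q, (0 < q)%N -> (q <= k.+1)%N -> (q <= h.+1)%N -> Th h q x = Th k q x.
  case: q => [|q] qh; first by rewrite T0 -[RHS]/(Th 0 0 x) T0.
  by apply: H.
elim: k => [|k IH] {}h {}q q0 qk qh.
  by case: q q0 qk qh => [|[|q]] // _ _ _; rewrite !Th1.
case: (ltnP 1 q) => [q1|]; last by case: q q0 qk qh => [|[|q]] //; rewrite !Th1.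
case: h qh => [|h] qh; first by case: q q1 qh {q0 qk} => [|[|]].
rewrite !ThS // !big_nat; apply: eq_bigr => i /andP[i0 iq].
have ik : (i <= k.+1)%N by rewrite -ltnS (leq_trans iq).
have ih : (i <= h.+1)%N by rewrite -ltnS (leq_trans iq).
have jk : (q - i <= k.+1)%N by rewrite leq_subLR (leq_trans qk) // -add1n leq_add2r.
have jh : (q - i <= h.+1)%N by rewrite leq_subLR (leq_trans qh) // -add1n leq_add2r.
by rewrite !(IH h) // subn_gt0.
Qed.

Lemma Tsum1 x : Tsum mul 1 x = x.
Proof. exact: Th1. Qed.

Lemma TsumE q x : (1 < q)%N ->
  Tsum mul q x = \sum_(1 <= i < q) mul (Tsum mul i x) (Tsum mul (q - i) x).
Proof.
case: q => // q q1; rewrite -(@Th_stable q.+1) // ThS // !big_nat.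
apply: eq_bigr => i /andP[i0 iq]; rewrite !Th_stable // ?(ltnW iq) //.
exact: leq_subr.
Qed.

End TsumTheory.

(* Main.v *)
(* An Engel subalgebra A lies in the kernel N of the weight, and an idempotent e
   gives the Peirce decomposition N = U + Z.  The Bernstein identity makes
   L = {l in U : lU = 0} an ideal of N with Z^2 <= L and L^2 = 0.  For x = u + z
   in A and w_k = z(z(...(zu))), almost all products of u, z, u^2 and the w_k
   vanish modulo L, so that T_q(x) = 2^(q-1) w_(q-1) and x^(k+1) = 2 w_k modulo L
   (x^(k+1) being the left-normed power, k and q large enough); the Engel
   condition then puts T_q(x) in L for large q.  Since T_i(x) annihilates L for
   i >= 3, the recurrence collapses to
     T_q(x) = 2 (x T_(q-1)(x) + T_2(x) T_(q-2)(x)).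
   Unrolled p times, this expresses T_q(x) through sums of all words with
   p - j letters L_x and j letters L_(T_2(x)), which are the coefficients in c
   of the p-th power of the multiplication by x + c T_2(x); since K is infinite,
   the Engel condition kills each of them. *)

Require Import Defs.
From HB Require Import structures.
From mathcomp Require Import all_boot all_algebra.
From mathcomp Require Import boolp classical_sets functions cardinality.
From mathcomp Require Import finmap.

Set Implicit Arguments.
Unset Strict Implicit.
Unset Printing Implicit Defensive.

Import GRing.Theory.

Local Open Scope classical_set_scope.
Local Open Scope ring_scope.

(** * Vector-valued polynomials over an infinite field *)

Lemma vector_poly_eq0 (K : fieldType) (V : lmodType K) n (v : 'I_n -> V) :
    infinite_set [set: K] ->
    (forall c : K, \sum_(i < n) c ^+ i *: v i = 0) ->
  forall i, v i = 0.
Proof.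
move=> Kinf v0.
(* The coefficients are recovered from the values at [n] distinct scalars by inverting a Vandermonde
   matrix. *)
have [S _ nS] := infinite_set_fset n Kinf.
pose M := Vandermonde n (\row_(j < n) (enum_fset S)`_j).
have Mu : M \in unitmx.
  rewrite unitmxE det_Vandermonde unitfE; apply/prodf_neq0 => i _.
  apply/prodf_neq0 => j ij; rewrite !mxE subr_eq0 nth_uniq ?fset_uniq //.
  - by rewrite gtn_eqF.
  - exact: leq_trans nS.
  - exact: leq_trans nS.
move=> i; transitivity (\sum_j (M *m invmx M) j i *: v j).
  rewrite mulmxV // (bigD1 i) //= mxE eqxx scale1r big1 ?addr0 // => j /negPf ji.
  by rewrite mxE ji scale0r.
under eq_bigr do rewrite mxE scaler_suml.
rewrite exchange_big big1 // => k _ /=.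
transitivity (invmx M k i *: \sum_j M j k *: v j).
  by rewrite scaler_sumr; apply: eq_bigr => j _; rewrite scalerA mulrC.
by under eq_bigr do rewrite !mxE; rewrite v0 scaler0.
Qed.

(** * The Bernstein identity and the Peirce components of an idempotent *)

Section Peirce.
Variables (K : fieldType) (B : lmodType K) (mul : {bilinear B -> B -> B}).
Variable (omega : {scalar B}).
Hypotheses (Kinf : infinite_set [set: K]) (two_neq0 : 2%:R != 0 :> K).
Hypothesis mulC : commutative mul.
Hypothesis omegaM : forall x y, omega (mul x y) = omega x * omega y.
Hypothesis bern :
  forall x, mul (mul x x) (mul x x) = omega x ^+ 2 *: mul x x.
Variable e : B.
Hypotheses (ee : mul e e = e) (omega_e : omega e = 1).

Local Notation "x ** y" := (mul x y) (at level 40, left associativity).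

Implicit Types (u v w z l n : B) (c : K).

Lemma mulr2_eq0 v : v *+ 2 = 0 -> v = 0.
Proof. by rewrite -scaler_nat => /eqP; rewrite scaler_eq0 (negPf two_neq0) => /eqP. Qed.

Lemma sqrD v w : (v + w) ** (v + w) = v ** v + (v ** w) *+ 2 + w ** w.
Proof. by rewrite linearDl !linearDr /= (mulC w v) mulr2n !addrA. Qed.

(* The coefficients in c of the Bernstein identity at e + c n. *)
Lemma bernstein_coefs n (a := (e ** n) *+ 2) (b := n ** n) : omega n = 0 ->
  [/\ (e ** a) *+ 2 = a, a ** a + (e ** b) *+ 2 = b, a ** b = 0 & b ** b = 0].
Proof.
move=> n0.
have sq c : (e + c *: n) ** (e + c *: n) = e + c *: (a + c *: b).
  rewrite sqrD ee !linearZr_LR linearZl_LR /= scalerDr -addrA.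
  by rewrite -scalerMnr.
(* Entry [i] is the degree [i] coefficient in [c] of the difference of the two sides; in degree 0
   both sides give [e]. *)
pose v : 'I_5 -> B := fun i => [:: 0; (e ** a) *+ 2 - a;
  a ** a + (e ** b) *+ 2 - b; (a ** b) *+ 2; b ** b]`_i.
suff /(vector_poly_eq0 Kinf) v0 : forall c, \sum_(i < 5) c ^+ i *: v i = 0.
  split; last exact: (v0 (@Ordinal 5 4 isT)).
  - by apply/eqP; rewrite -subr_eq0; apply/eqP/(v0 (@Ordinal 5 1 isT)).
  - by apply/eqP; rewrite -subr_eq0; apply/eqP/(v0 (@Ordinal 5 2 isT)).
  - exact/mulr2_eq0/(v0 (@Ordinal 5 3 isT)).
move=> c; have := bern (e + c *: n).
have -> : omega (e + c *: n) = 1 by rewrite linearD linearZ /= omega_e n0 mulr0 addr0.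
rewrite expr1n scale1r !sq sqrD ee.
rewrite -addrA => /addrI/eqP; rewrite -subr_eq0 => /eqP E.
rewrite !big_ord_recl big_ord0 /v /= scaler0 add0r addr0 -[RHS]E {E} /bump /=.
rewrite !addn0 !add1n expr1; clear v bern sq; move: a b => a b.
have -> : e ** (c *: (a + c *: b)) = c *: (e ** a) + c ^+ 2 *: (e ** b).
  by rewrite linearZr_LR linearDr linearZr_LR /= scalerDr scalerA.
have -> : (c *: (a + c *: b)) ** (c *: (a + c *: b)) =
    c ^+ 2 *: (a ** a) + (c ^+ 3 *: (a ** b)) *+ 2 + c ^+ 4 *: (b ** b).
  rewrite scalerDr scalerA sqrD !linearZr_LR !linearZl_LR /= !scalerA.
  by rewrite !exprS expr0 !mulr1 !mulrA.
rewrite -!scalerMnr !scalerDr !scalerN mulrnDl opprD scalerA -!mulr2n -expr2.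
by rewrite [RHS](AC (2*3*2) ((1*6)*(((3*2)*7)*(4*5)))).
Qed.

Lemma mulDD v w x y : (v + w) ** (x + y) = v ** x + v ** y + (w ** x + w ** y).
Proof. by rewrite linearDl !linearDr. Qed.

(** The Peirce spaces of [e] for the eigenvalues 1/2 and 0. *)
Definition Uspace v := (e ** v) *+ 2 = v.
Definition Zspace v := e ** v = 0.

Lemma Ulin c u v : Uspace u -> Uspace v -> Uspace (c *: u + v).
Proof.
by rewrite /Uspace linearDr linearZr_LR /= mulrnDl scalerMnr => -> ->.
Qed.

Lemma Zlin c u v : Zspace u -> Zspace v -> Zspace (c *: u + v).
Proof. by rewrite /Zspace linearDr linearZr_LR /= => -> ->; rewrite scaler0 addr0. Qed.

Lemma U0 : Uspace 0. Proof. by rewrite /Uspace linear0r mul0rn. Qed.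
Lemma Z0 : Zspace 0. Proof. by rewrite /Zspace linear0r. Qed.

#[local] Hint Resolve U0 Z0 : core.

Lemma UZ0 v : Uspace v -> Zspace v -> v = 0.
Proof. by rewrite /Uspace /Zspace => + ev0; rewrite ev0 mul0rn => <-. Qed.

Lemma omegaU v : Uspace v -> omega v = 0.
Proof.
move=> Uv; have : omega v = omega v *+ 2.
  by rewrite -{1}Uv linearMn /= omegaM omega_e mul1r.
by rewrite mulr2n => /eqP; rewrite eq_sym -subr_eq0 addrK => /eqP.
Qed.

Lemma omegaZ v : Zspace v -> omega v = 0.
Proof. by move=> Zv; rewrite -[LHS]mul1r -omega_e -omegaM Zv linear0. Qed.

(** The U-component is [2en]: the degree 1 coefficient makes multiplication by [2e] idempotent on
    the kernel of [omega]. *)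
Lemma peirce n : omega n = 0 ->
  exists u z, [/\ Uspace u, Zspace z & n = u + z].
Proof.
move=> n0; have [Un _ _ _] := bernstein_coefs n0.
exists ((e ** n) *+ 2), (n - (e ** n) *+ 2); split=> //; last by rewrite addrC subrK.
rewrite /Zspace linearBr linearMnr /=.
apply: mulr2_eq0; rewrite mulrnBl -[X in _ - X *+ 2]linearMnr /=.
by rewrite Un subrr.
Qed.

Lemma UD u v : Uspace u -> Uspace v -> Uspace (u + v).
Proof. by move=> Uu Uv; rewrite -[u]scale1r; apply: Ulin. Qed.
Lemma UN u : Uspace u -> Uspace (- u).
Proof. move=> Uu; rewrite -scaleN1r -[_ *: u]addr0. by apply: Ulin. Qed.
Lemma ZD u v : Zspace u -> Zspace v -> Zspace (u + v).
Proof. by move=> Zu Zv; rewrite -[u]scale1r; apply: Zlin. Qed.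
Lemma ZN u : Zspace u -> Zspace (- u).
Proof. by move=> Zu; rewrite -scaleN1r -[_ *: u]addr0; apply: Zlin. Qed.

Lemma UMn v k : Uspace v -> Uspace (v *+ k).
Proof. by move=> Uv; elim: k => // k IH; rewrite mulrS; apply: UD. Qed.
Lemma ZMn v k : Zspace v -> Zspace (v *+ k).
Proof. by move=> Zv; elim: k => // k IH; rewrite mulrS; apply: ZD. Qed.

Lemma halfU v : Uspace (v *+ 2) -> Uspace v.
Proof.
move=> U2; rewrite -[v](@scalerK _ _ 2%:R) // scaler_nat -[_ *: _]addr0.
exact: Ulin.
Qed.
Lemma halfZ v : Zspace (v *+ 2) -> Zspace v.
Proof. by rewrite /Zspace linearMnr /= => /mulr2_eq0. Qed.

Lemma peirce_eqs u z (n := u + z) : Uspace u -> Zspace z ->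
  [/\ u ** u + (e ** (n ** n)) *+ 2 = n ** n, u ** (n ** n) = 0
    & (n ** n) ** (n ** n) = 0].
Proof.
move=> Uu Zz; have n0 : omega n = 0 by rewrite linearD omegaU ?omegaZ //= addr0.
have en : (e ** n) *+ 2 = u by rewrite /n linearDr /= Zz addr0.
by have [_] := bernstein_coefs n0; rewrite en.
Qed.

Lemma polarize v w x : v + x *+ 2 + w = 0 -> v = 0 -> w = 0 -> x = 0.
Proof. by move=> E v0 w0; move: E; rewrite v0 w0 add0r addr0 => /mulr2_eq0. Qed.

(** Separates the even and odd parts of an identity known at [u + z] and [u - z], or at [u + v] and
    [u - v]. *)
Lemma parity v w : v + w = 0 -> v - w = 0 -> v = 0 /\ w = 0.
Proof.
move=> p m; suff w0 : w = 0 by move: p; rewrite w0 addr0.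
by apply: mulr2_eq0; rewrite mulr2n -(subrKA v) p addr0 -opprB m oppr0.
Qed.

(** * Multiplication rules for the Peirce components *)

Lemma sqU u : Uspace u -> Zspace (u ** u).
Proof.
move=> Uu; have [+ _ _] := peirce_eqs Uu Z0; rewrite addr0.
by move=> /eqP; rewrite -subr_eq0 addrAC subrr add0r => /eqP/mulr2_eq0.
Qed.

Lemma UU u v : Uspace u -> Uspace v -> Zspace (u ** v).
Proof.
move=> Uu Uv; have := sqU (UD Uu Uv); rewrite sqrD => Zs; apply: halfZ.
rewrite -[_ *+ 2](addKr (u ** u)) -[X in - _ + X](addrK (v ** v)).
apply: ZD; first exact/ZN/sqU.
by apply: ZD => //; apply/ZN/sqU.
Qed.

Lemma sqZ z : Zspace z -> Uspace (z ** z).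
Proof. by move=> Zz; have [+ _ _] := peirce_eqs U0 Zz; rewrite !add0r linear0l add0r. Qed.

Lemma ZZ z w : Zspace z -> Zspace w -> Uspace (z ** w).
Proof.
move=> Zz Zw; have := sqZ (ZD Zz Zw); rewrite sqrD => Us; apply: halfU.
rewrite -[_ *+ 2](addKr (z ** z)) -[X in - _ + X](addrK (w ** w)).
apply: UD; first exact/UN/sqZ.
by apply: UD => //; apply/UN/sqZ.
Qed.

Lemma UZ u z : Uspace u -> Zspace z -> Uspace (u ** z).
Proof.
move=> Uu Zz; apply: halfU; have [+ _ _] := peirce_eqs Uu Zz.
rewrite sqrD !linearDr /= (sqU Uu) add0r mulrnDl -!addrA => /addrI.
rewrite sqZ // !addrA => /addIr; rewrite /Uspace !mulr2n linearDr /= !addrA; exact.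
Qed.

Lemma ZU u z : Uspace u -> Zspace z -> Uspace (z ** u).
Proof. by rewrite mulC; apply: UZ. Qed.

(** The identity u n^2 = 0 at n = u + z and n = u - z has, once u^3 = 0 is removed, even part u z^2
    and odd part 2u(uz). *)
Lemma cubic u z : Uspace u -> Zspace z -> u ** (z ** z) = 0 /\ u ** (u ** z) = 0.
Proof.
move=> Uu Zz; have [_ Eu _] := peirce_eqs Uu Z0.
have [_ Ep _] := peirce_eqs Uu Zz; have [_ Em _] := peirce_eqs Uu (ZN Zz).
rewrite addr0 in Eu.
move: Em; rewrite sqrD linearNl !linearNr opprK 2!linearDr Eu add0r mulNrn.
rewrite linearNr addrC => m.
move: Ep; rewrite sqrD 2!linearDr Eu add0r addrC => p.
by have [-> /=] := parity p m; rewrite linearMnr => /mulr2_eq0.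
Qed.

Lemma cubeU u : Uspace u -> u ** (u ** u) = 0.
Proof. by move=> Uu; have [_ + _] := peirce_eqs Uu Z0; rewrite addr0. Qed.

Lemma U_ZZ u z w : Uspace u -> Zspace z -> Zspace w -> u ** (z ** w) = 0.
Proof.
move=> Uu Zz Zw; have [+ _] := cubic Uu (ZD Zz Zw).
rewrite sqrD 2!linearDr linearMnr => /polarize.
by apply; case: (cubic Uu Zz) (cubic Uu Zw) => ? _ [].
Qed.

Lemma U_UZ u v z : Uspace u -> Uspace v -> Zspace z ->
  u ** (v ** z) = - (v ** (u ** z)).
Proof.
move=> Uu Uv Zz; have [_ +] := cubic (UD Uu Uv) Zz.
rewrite !linearDl !linearDr /=.
have [_ ->] := cubic Uu Zz; have [_ ->] := cubic Uv Zz.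
by rewrite add0r addr0 => /eqP; rewrite addr_eq0 => /eqP.
Qed.

(** With P = u^2 + z^2 and Q = 2uz, the identity n^2 n^2 = 0 at u + z and u - z gives P^2 + Q^2 = 0
    and PQ = 0. Here P^2 = 2 u^2 z^2 lies in U and Q^2 in Z, so both vanish. *)
Lemma quartic u z : Uspace u -> Zspace z ->
  (u ** u) ** (u ** z) = 0 /\ (u ** z) ** (u ** z) = 0.
Proof.
move=> Uu Zz; have [_ _ Eu] := peirce_eqs Uu Z0; have [_ _ Ez] := peirce_eqs U0 Zz.
have [_ _ Ep] := peirce_eqs Uu Zz; have [_ _ Em] := peirce_eqs Uu (ZN Zz).
have uzzz : (u ** z) ** (z ** z) = 0 by apply: U_ZZ => //; apply: UZ.
rewrite addr0 in Eu; rewrite add0r in Ez.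
pose P := u ** u + z ** z; pose Q := (u ** z) *+ 2.
have sqp : (u + z) ** (u + z) = P + Q by rewrite sqrD addrAC.
have sqm : (u - z) ** (u - z) = P - Q.
  by rewrite sqrD linearNl !linearNr opprK mulNrn addrAC.
have [PPQQ PQ] : P ** P + Q ** Q = 0 /\ (P ** Q) *+ 2 = 0.
  apply: parity; first by rewrite addrAC -sqrD -sqp.
  by rewrite addrAC -mulNrn -linearNr /= -[Q ** Q]opprK -linearNl -linearNr -sqrD -sqm.
have suz : (u ** u) ** (u ** z) = 0.
  move/mulr2_eq0: PQ; rewrite linearMnr => /mulr2_eq0.
  by rewrite /P linearDl [X in _ + X]mulC uzzz addr0.
split=> //; apply/mulr2_eq0/mulr2_eq0/UZ0; last first.
  by rewrite -!mulrnA; apply: ZMn; apply: UU; apply: UZ.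
have <- : Q ** Q = (u ** z) ** (u ** z) *+ 2 *+ 2 by rewrite linearMnl linearMnr.
move/eqP: PPQQ; rewrite addrC addr_eq0 => /eqP ->; apply: UN.
rewrite sqrD Eu Ez add0r addr0; apply: UMn; rewrite mulC.
by apply: UZ; [apply: sqZ|apply: sqU].
Qed.

(** Polarizes u^2(uz) = 0 at u + v and u - v: since (uv)(uz) = 0, the only term that changes sign is
    (u^2 + v^2)(vz), and v^2(vz) = 0. *)
Lemma squU u v z : Uspace u -> Uspace v -> Zspace z ->
  (u ** v) ** (u ** z) = 0 -> (u ** u) ** (v ** z) = 0.
Proof.
move=> Uu Uv Zz uvuz.
have [su _] := quartic Uu Zz; have [tv _] := quartic Uv Zz.
have [Ep _] := quartic (UD Uu Uv) Zz; have [Em _] := quartic (UD Uu (UN Uv)) Zz.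
pose P := u ** u + v ** v; pose Q := (u ** v) *+ 2.
have PU : P ** (u ** z) = (v ** v) ** (u ** z) by rewrite linearDl su add0r.
have PV : P ** (v ** z) = (u ** u) ** (v ** z) by rewrite linearDl tv addr0.
have QU : Q ** (u ** z) = 0 by rewrite linearMnl uvuz mul0rn.
have [] : P ** (u ** z) + Q ** (v ** z) = 0 /\ P ** (v ** z) = 0; last by rewrite PV.
apply: parity.
  move: Ep; rewrite sqrD addrAC -/P -/Q.
  have -> : (u + v) ** z = u ** z + v ** z by rewrite linearDl.
  by rewrite mulDD QU add0r addrAC.
move: Em; rewrite sqrD linearNl !linearNr opprK mulNrn addrAC -/P -/Q.
have -> : (u - v) ** z = u ** z - v ** z by rewrite linearBl.
rewrite mulDD.
by rewrite !linearNl !linearNr opprK QU oppr0 add0r addrAC.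
Qed.

(** * The ideal L *)

Definition Lspace l := Uspace l /\ forall u, Uspace u -> l ** u = 0.

Lemma L0 : Lspace 0. Proof. by split=> // u _; rewrite linear0l. Qed.

#[local] Hint Resolve L0 : core.

Lemma Llin c l m : Lspace l -> Lspace m -> Lspace (c *: l + m).
Proof.
move=> [Ul l0] [Um m0]; split; first exact: Ulin.
by move=> u Uu; rewrite linearDl linearZl_LR /= l0 // m0 // scaler0 addr0.
Qed.

Lemma LD l m : Lspace l -> Lspace m -> Lspace (l + m).
Proof. by move=> Ll Lm; rewrite -[l]scale1r; apply: Llin. Qed.
Lemma LZ c l : Lspace l -> Lspace (c *: l).
Proof. by move=> Ll; rewrite -[_ *: _]addr0; apply: Llin. Qed.

Lemma LZZ z w : Zspace z -> Zspace w -> Lspace (z ** w).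
Proof.
move=> Zz Zw; split; first exact: ZZ.
by move=> u Uu; rewrite mulC U_ZZ.
Qed.

(** For v in U, v(lz) = -l(vz), and vz is again in U. *)
Lemma Lmul l n : Lspace l -> omega n = 0 -> Lspace (l ** n).
Proof.
move=> [Ul l0] /peirce[u [z [Uu Zz ->]]]; rewrite linearDr l0 // add0r.
split; first exact: UZ.
by move=> v Uv; rewrite mulC U_UZ // l0 ?oppr0 //; apply: UZ.
Qed.

Lemma LL l m : Lspace l -> Lspace m -> l ** m = 0.
Proof. by move=> [_ l0] [Um _]; exact: l0. Qed.

Lemma omegaL l : Lspace l -> omega l = 0.
Proof. by case=> /omegaU. Qed.

Lemma LB l m : Lspace l -> Lspace m -> Lspace (l - m).
Proof. by move=> Ll Lm; rewrite addrC -scaleN1r; apply: Llin. Qed.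

Lemma Lsum I (r : seq I) (P : pred I) (F : I -> B) :
  (forall i, P i -> Lspace (F i)) -> Lspace (\sum_(i <- r | P i) F i).
Proof. by move=> LF; apply: big_ind LF => //; apply: LD. Qed.

Lemma LMn l k : Lspace l -> Lspace (l *+ k).
Proof. by move=> Ll; rewrite -scaler_nat; apply: LZ. Qed.

(** * The sums T_q at a single element [u + z], modulo L *)

Section OneGenerator.
Variables u z : B.
Hypotheses (Uu : Uspace u) (Zz : Zspace z).

Let x := u + z.
Let w k := iter k (mul z) u.
Let s := u ** u.

Lemma Uw k : Uspace (w k).
Proof. by elim: k => //= k IH; apply: ZU. Qed.

#[local] Hint Resolve Uw : core.

Lemma wS k : w k.+1 = w k ** z.
Proof. by rewrite mulC. Qed.

(** Induction on j - i for i <= j: [U_UZ] turns w_i (w_(j-1) z) into -w_(j-1) w_(i+1), lowering the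
    difference by 2. Difference 0 is [quartic]; for difference 1 the product equals its own
    opposite. *)
Lemma ww i j : (0 < i + j)%N -> w i ** w j = 0.
Proof.
wlog ij : i j / (i <= j)%N => [H|].
  by case/orP: (leq_total i j) => ? ?; [|rewrite mulC]; apply: H; rewrite // addnC.
rewrite -(subnKC ij); move: (j - i)%N => d {j ij}.
elim/ltn_ind: d i => -[|[|d]] IH i.
- case: i => [|i] // _; rewrite addn0 !wS.
  by have [] := quartic (Uw i) Zz.
- move=> _; rewrite addn1 wS; apply: mulr2_eq0.
  by rewrite mulr2n {1}U_UZ // addNr.
- move=> _; rewrite !addnS wS U_UZ // -wS mulC -addSn IH ?oppr0 //.
Qed.

Lemma sw k : s ** w k = 0.
Proof.
case: k => [|[|k]]; first by rewrite mulC; exact: cubeU.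
  by rewrite wS; have [] := quartic Uu Zz.
rewrite wS; apply: squU => //.
by rewrite -[u in u ** w _]/(w 0) ww // linear0l.
Qed.

(* T_q(u + z) modulo L. *)
Definition residue q : B :=
  match q with
  | 0 => 0 | 1 => x | 2 => s + w 1 *+ 2 | q'.+1 => w q' *+ 2 ^ q'
  end.

Lemma residueS q : residue q.+3 = w q.+2 *+ 2 ^ q.+2. Proof. by []. Qed.

Lemma omega_residue q : omega (residue q) = 0.
Proof.
case: q => [|[|[|q]]]; rewrite /= ?linear0 //.
- by rewrite linearD omegaU ?omegaZ //= addr0.
- by rewrite linearD omegaZ ?omegaU ?addr0 //; [apply/UMn/(Uw 1)|apply: sqU].
- exact/omegaU/UMn/(Uw q.+2).
Qed.

(** By [ww] and [sw] all products of terms are exactly zero except [s ** s], which lies in L by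
    [LZZ]. *)
Lemma residueM i j : Lspace (residue i.+2 ** residue j.+2).
Proof.
have R2 k : residue 2 ** w k.+1 = 0.
  by rewrite linearDl sw linearMnl ww // mul0rn addr0.
case: i j => [|i] [|j]; rewrite ?residueS ?linearMnl ?linearMnr.
- rewrite {2}/residue linearDr linearMnr R2 mul0rn addr0 /= linearDl.
  rewrite linearMnl [w 1 ** s]mulC (sw 1) mul0rn addr0.
  by apply: LZZ; apply: sqU.
- by rewrite R2 mul0rn.
- by rewrite mulC R2 mul0rn.
- by rewrite ww // !mul0rn.
Qed.

(** Since [u] kills every w_k with k > 0, [x] acts on these as [z]; the only defect is 2zs, for
    [q = 0], and it lies in L. *)
Lemma residue_step q : Lspace ((x ** residue q.+2) *+ 2 - residue q.+3).
Proof.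
have xw k : x ** w k.+1 = w k.+2.
  by rewrite /x linearDl -[u in u ** _]/(w 0) ww // add0r.
case: q => [|q]; last first.
  by rewrite residueS linearMnr xw residueS -mulrnA mulnC -expnS subrr.
rewrite residueS /residue linearDr linearMnr xw mulrnDl -mulrnA addrK.
rewrite /x linearDl cubeU // add0r; apply/LMn/LZZ => //; exact: sqU.
Qed.

Lemma Tsum_residue q : (0 < q)%N -> Lspace (Tsum mul q x - residue q).
Proof.
elim/ltn_ind: q => -[|[|[|q]]] // IH _; first by rewrite Tsum1 subrr.
  rewrite TsumE // big_nat1 Tsum1 /= sqrD mulC -/s.
  by rewrite addrAC addrN add0r; apply: LZZ.
have LT i : (0 < i < q.+3)%N ->
    Lspace (Tsum mul i x ** Tsum mul (q.+3 - i) x - residue i ** residue (q.+3 - i)).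
  move=> /andP[i0 iq].
  have Li := IH i iq i0; have Lj : Lspace (Tsum mul (q.+3 - i) x - residue (q.+3 - i)).
    by apply: IH; [rewrite ltn_subrL i0|rewrite subn_gt0].
  rewrite -(subrKA (residue i ** Tsum mul (q.+3 - i) x)) -linearBr -linearBl /=.
  apply: LD.
    apply: Lmul => //; rewrite -[Tsum _ _ _](subrK (residue (q.+3 - i))).
    by rewrite linearD omega_residue omegaL // addr0.
  by rewrite mulC; apply: Lmul (omega_residue _).
rewrite TsumE // -(subrKA (\sum_(1 <= i < q.+3) residue i ** residue (q.+3 - i))).
apply: LD.
  by rewrite -sumrB big_nat; apply: Lsum => i; apply: LT.
(* Modulo L only the first and last terms survive, both equal to [x ** residue q.+2]. *)
rewrite big_ltn // big_nat_recr // subn1 subSnn -[residue 1]/x.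
rewrite [residue q.+2 ** x]mulC addrCA -addrA; apply: LD; last first.
  by rewrite -mulr2n; apply: residue_step.
rewrite big_nat; apply: Lsum => i /andP[i2 iq].
by rewrite -{1}(subnKC i2) add2n 2?subSn ?(ltnW iq) //; apply: residueM.
Qed.

(** Suitably scaled left-normed powers obey the recursion of [residue_step], so a vanishing power
    puts [residue p.+1] in L; the ideal property propagates this to larger indices. *)
Lemma engel_residue p : (0 < p)%N -> iter p (mul x) x = 0 ->
  forall q, (p < q)%N -> Lspace (residue q).
Proof.
move=> p0 xp0 q; elim: q => // q IH; rewrite ltnS leq_eqVlt => /predU1P[<-|pq].
  have powx k : Lspace (iter k.+1 (mul x) x *+ 2 ^ k - residue k.+2).
    elim: k => [|k IHk].
      rewrite /= sqrD [z ** u]mulC addrAC addrN add0r; exact: LZZ.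
    rewrite iterS -(subrKA (x ** residue k.+2 *+ 2)); apply: LD.
      rewrite expnSr mulrnA -mulrnBl -linearMnr -linearBr; apply: LMn.
      rewrite mulC; apply: Lmul => //.
      by rewrite linearD omegaU ?omegaZ //= addr0.
    exact: residue_step.
  have := powx p.-1; rewrite prednK // xp0 mul0rn sub0r => /(LZ (-1)).
  by rewrite scaleN1r opprK.
case: q pq IH => [|[|q]] // pq IH; first by case: p pq p0 {xp0 IH} => [|[]].
rewrite -[residue q.+3](subKr (x ** residue q.+2 *+ 2)).
apply: LB; last exact: residue_step.
apply: LMn; rewrite mulC; apply: Lmul; first exact: IH.
by rewrite linearD omegaU ?omegaZ //= addr0.
Qed.

Lemma engel_Tsum p : (0 < p)%N -> iter p (mul x) x = 0 ->
  forall q, (p < q)%N -> Lspace (Tsum mul q x).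
Proof.
move=> p0 xp0 q pq; rewrite -[Tsum _ _ _](subrK (residue q)).
by apply: LD; [apply: Tsum_residue; apply: leq_trans pq|apply: engel_residue p0 _ _ _].
Qed.

(** For [q > 2] the residue is a multiple of some w_k, hence in U and annihilated by L; the rest of
    T_q is in L, and L^2 = 0. *)
Lemma Lspace_Tsum l q : Lspace l -> (2 < q)%N -> l ** Tsum mul q x = 0.
Proof.
case: q => [|[|[|q]]] // Ll _.
rewrite -[Tsum _ _ _](subrK (residue q.+3)) linearDr.
rewrite LL ?add0r //; last exact: Tsum_residue.
by case: Ll => _; apply; apply/UMn/Uw.
Qed.

Lemma Tsum_rec_sum p q : (0 < p)%N -> iter p (mul x) x = 0 ->
    (4 < q)%N -> (p.*2 < q)%N ->
  Tsum mul q x =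
    (x ** Tsum mul q.-1 x + Tsum mul 2 x ** Tsum mul q.-2 x) *+ 2.
Proof.
move=> p0 xp0; case: q => [|[|[|[|[|q]]]]] // _ pq.
rewrite TsumE // big_ltn // big_ltn // big_nat_recr // big_nat_recr //=.
have -> : (q.+4.+1 - q.+3 = 2)%N by rewrite !subSS -addn2 addKn.
rewrite subn1 subn2 subSnn Tsum1 /=.
rewrite big_nat big1 => [|i /andP[i2 iq]].
  by rewrite add0r [Tsum mul q.+3 x ** _]mulC [Tsum mul q.+4 x ** _]mulC mulr2n
    -!addrA [X in _ + (_ + X)]addrC.
have jq : (2 < q.+4.+1 - i)%N by rewrite ltn_subRL addnC !addSn !ltnS in iq *.
(* The two indices sum to more than 2p, so one exceeds p and its factor lies in L; the other is at
   least 3, so its factor annihilates L. *)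
have [ip|pi] := leqP i p; last by apply: Lspace_Tsum (engel_Tsum p0 xp0 pi) jq.
rewrite mulC; apply: Lspace_Tsum i2; apply: engel_Tsum p0 xp0 _ _.
by rewrite ltn_subRL (leq_ltn_trans _ pq) // -addnn leq_add2r.
Qed.

End OneGenerator.

Lemma Tsum_rec n p q : omega n = 0 -> (0 < p)%N -> iter p (mul n) n = 0 ->
    (4 < q)%N -> (p.*2 < q)%N ->
  Tsum mul q n =
    (n ** Tsum mul q.-1 n + Tsum mul 2 n ** Tsum mul q.-2 n) *+ 2.
Proof. by move=> /peirce[u [z [Uu Zz ->]]]; apply: Tsum_rec_sum. Qed.

End Peirce.

(** * Words in two left multiplications *)

Section Words.
Variables (K : fieldType) (B : lmodType K) (mul : {bilinear B -> B -> B}).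
Implicit Types x y a : B.

(* The sum of all products of k left multiplications applied to a, of which j
   are by y and k - j by x. *)
Fixpoint word_sum x y a k j : B :=
  match k with
  | 0 => if j is 0 then a else 0
  | k'.+1 => mul x (word_sum x y a k' j) +
      (if j is j'.+1 then mul y (word_sum x y a k' j') else 0)
  end.

Lemma word_sum_eq0 x y a k j : (k < j)%N -> word_sum x y a k j = 0.
Proof.
elim: k j => [|k IH] [|j] //= kj.
by rewrite !IH ?linear0r ?addr0 // ltnW.
Qed.

(** Sorts the words by their first letter. [iter_mulD] needs the weights [c] to vary with [j],
    [unroll_word_sum] the vectors [F]. *)
Lemma word_sum_recr x y k (F : nat -> B) (c : nat -> K) :
  \sum_(j < k.+2) c j *: word_sum x y (F j) k.+1 j =
  mul x (\sum_(j < k.+1) c j *: word_sum x y (F j) k j) +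
  mul y (\sum_(j < k.+1) c j.+1 *: word_sum x y (F j.+1) k j).
Proof.
under eq_bigr do rewrite /= scalerDr.
rewrite big_split !linear_sumr; congr (_ + _).
  rewrite big_ord_recr /= word_sum_eq0 // linear0r scaler0 addr0.
  by apply: eq_bigr => j _; rewrite linearZr_LR.
rewrite big_ord_recl /= scaler0 add0r.
by apply: eq_bigr => j _; rewrite linearZr_LR.
Qed.

Lemma iter_mulD x y a c k :
  iter k (mul (x + c *: y)) a = \sum_(j < k.+1) c ^+ j *: word_sum x y a k j.
Proof.
elim: k => [|k IH]; first by rewrite big_ord1 scale1r.
rewrite iterS IH word_sum_recr linearDl; congr (_ + _).
rewrite linearZl_LR -linearZr_LR scaler_sumr /=.
by congr (mul y _); apply: eq_bigr => j _; rewrite scalerA exprS.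
Qed.

(** Each letter [x] lowers the index by 1 and each [y] by 2, so a word with [j] letters [y] ends at
    [q - k - j]; the bound on [q] keeps every use of the recurrence in range. *)
Lemma unroll_word_sum x y (T : nat -> B) m k q :
    (forall q, (m <= q)%N -> T q = (mul x (T q.-1) + mul y (T q.-2)) *+ 2) ->
    (m + k.*2 <= q)%N ->
  T q = (\sum_(j < k.+1) word_sum x y (T (q - k - j)%N) k j) *+ 2 ^ k.
Proof.
move=> Trec; elim: k q => [|k IH] q mkq; first by rewrite big_ord1 !subn0.
have mkq2 : (m + k.*2 <= q.-2)%N.
  by rewrite -subn2 leq_subRL ?(leq_trans _ mkq) // doubleS !addnS // addnC.
have mkq1 : (m + k.*2 <= q.-1)%N by apply: leq_trans mkq2 (leq_pred _).
have mq : (m <= q)%N by apply: leq_trans mkq; apply: leq_addr.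
rewrite Trec // (IH _ mkq1) (IH _ mkq2) !linearMnr -mulrnDl -mulrnA -expnSr.
congr (_ *+ _); under [RHS]eq_bigr do rewrite -[word_sum _ _ _ _ _]scale1r.
rewrite (word_sum_recr _ _ _ (fun j => T (q - k.+1 - j)%N) (fun=> 1)).
congr (mul x _ + mul y _); apply: eq_bigr => j _; rewrite scale1r.
  by rewrite -subn1 -(subnDA 1).
by rewrite -subn2 -!subnDA !(addSn, addnS).
Qed.

End Words.

Theorem theorem0p5 (K : fieldType)
    (Kinf : infinite_set [set: K])
    (K2 : 2%N \notin [pchar K]) (K3 : 3%N \notin [pchar K])
    (B : lmodType K) (mul : {bilinear B -> B -> B}) (A : set B) :
  bernstein mul -> subalgebra mul A -> engel mul A -> yagzhev mul A.
Proof.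
move=> [mulC [omega [[x0 x0_neq0] omegaM bern]]] [A0 Alin AM] [p p0 engelA].
have two_neq0 : 2%:R != 0 :> K by move: K2; rewrite inE.
(* At weight 1 the Bernstein identity says that the square is idempotent. *)
pose x1 := (omega x0)^-1 *: x0; pose e := mul x1 x1.
have omega_x1 : omega x1 = 1 by rewrite linearZ /= mulVf.
have omega_e : omega e = 1 by rewrite omegaM omega_x1 mulr1.
have ee : mul e e = e by rewrite bern omega_x1 expr1n scale1r.
have omegaA x : A x -> omega x = 0.
  move=> Ax; have omega_pow k : omega (iter k (mul x) x) = omega x ^+ k.+1.
    by elim: k => [|k IH] //; rewrite iterS omegaM IH -exprS.
  by apply/eqP; have := omega_pow p; rewrite engelA // linear0 => /esym/eqP;
    rewrite expf_eq0.
have AT q x : A x -> A (Tsum mul q x).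
  move=> Ax; elim/ltn_ind: q => -[|[|q]] IH.
  - by rewrite /Tsum big1 // => t; rewrite eqn0Ngt leaves_gt0.
  - by rewrite Tsum1.
  rewrite TsumE // big_nat; apply: big_ind => // [y z Ay Az|i /andP[i0 iq]].
    by rewrite -[y]scale1r; apply: Alin.
  by apply: AM; apply: IH => //; rewrite ltn_subrL i0.
(* The recurrence holds from [p.*2 + 5] on, and unrolling it [p] times costs at most [p.*2] more. *)
exists (p.*2 + 5 + p.*2)%N => [|x q Ax pq]; first by rewrite addnS.
have word0 a (j : 'I_p.+1) : A a -> word_sum mul x (Tsum mul 2 x) a p j = 0.
  move=> Aa; move: j; apply: (vector_poly_eq0 Kinf) => c.
  rewrite -iter_mulD engelA // addrC.
  by apply: Alin => //; apply: AT.
have xp0 : iter p (mul x) x = 0 by apply: engelA.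
have Trec r : (p.*2 + 5 <= r)%N -> Tsum mul r x =
    (mul x (Tsum mul r.-1 x) + mul (Tsum mul 2 x) (Tsum mul r.-2 x)) *+ 2.
  move=> pr; apply: (Tsum_rec Kinf two_neq0 mulC omegaM bern ee omega_e) p0 xp0 _ _.
  - exact: omegaA.
  - by apply: leq_trans pr; rewrite leq_addl.
  - by apply: leq_trans pr; rewrite addnS ltnS leq_addr.
have -> := unroll_word_sum (T := fun r => Tsum mul r x) Trec pq.
by rewrite big1 ?mul0rn // => j _; apply: word0; apply: AT.
Qed.
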